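(* Let $\mathsf E$ and $\mathsf F$ be smooth Borel equivalence relations on $(2^\omega)^\omega$. Then there is an infinite perfect product $P\subseteq(2^\omega)^\omega$ such that either (a) $\mathsf F\subseteq\mathsf E$ on $P$, i.e. for all $x,y\in P$, $x\,\mathsf F\,y$ implies $x\,\mathsf E\,y$; or (b) there is $j<\omega$ such that $\mathsf E$ captures $j$ on $P$ and $\mathsf F$ is reduced to $\omega\setminus\{j\}$ on $P$; that is, for all $x,y\in P$: $x\,\mathsf E\,y$ implies $x(j)=y(j)$, and $x\restriction(\omega\setminus\{j\})=y\restriction(\omega\setminus\{j\})$ implies $x\,\mathsf F\,y$.
   Context: An infinite perfect product is a set $P\subseteq(2^\omega)^\omega$ of the form $P=\prod_{k<\omega}P(k)$ where each $P(k)=\{x(k):x\in P\}\subseteq 2^\omega$ is a nonempty perfect set. An equivalence relation $\mathsf E$ on $(2^\omega)^\omega$ is smooth if there is a Borel map $f:(2^\omega)^\omega\to 2^\omega$ with $x\,\mathsf E\,y\iff f(x)=f(y)$. For $x\in(2^\omega)^\omega$ and $U\subseteq\omega$, $x\restriction U$ denotes the restriction of the sequence $x$ to the index set $U$. $\mathsf E$ captures $j$ on $P$ if $x\,\mathsf E\,y$ implies $x(j)=y(j)$ for all $x,y\in P$; $\mathsf E$ is reduced to $U\subseteq\omega$ on $P$ if $x\restriction U=y\restriction U$ implies $x\,\mathsf E\,y$ for all $x,y\in P$. *)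

(* Defs.v *)
From HB Require Import structures.
From mathcomp Require Import all_boot all_order all_algebra.
From mathcomp Require Import boolp classical_sets functions.
From mathcomp Require Import topology cantor measure.
From Stdlib Require Import RelationClasses.
Set Implicit Arguments.
Unset Strict Implicit.
Unset Printing Implicit Defensive.

Local Open Scope classical_set_scope.

Definition cantor_seq : Type := prod_topology (fun _ : nat => cantor_space).

HB.instance Definition _ := Pointed.on cantor_seq.
HB.instance Definition _ := Nbhs.on cantor_seq.
HB.instance Definition _ := Topological.on cantor_seq.

Definition borel_set (T : topologicalType) (A : set T) : Prop :=
  <<s @open T >> A.

(* The measurable sets of [g_sigma_algebraType open] are the [borel_set]s. *)
Definition borel_map (T U : ptopologicalType) (f : T -> U) : Prop :=
  measurable_fun setT
    (f : g_sigma_algebraType (@open T) -> g_sigma_algebraType (@open U)).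

Definition borel_equivalence (E : cantor_seq -> cantor_seq -> Prop) : Prop :=
  Equivalence E /\
  borel_set [set p : cantor_seq * cantor_seq | E p.1 p.2].

Definition smooth (E : cantor_seq -> cantor_seq -> Prop) : Prop :=
  exists2 f : cantor_seq -> cantor_space,
    borel_map f & forall x y, E x y <-> f x = f y.

Definition coord (P : set cantor_seq) (k : nat) : set cantor_space :=
  [set x k | x in P].

Definition perfect_product (P : set cantor_seq) : Prop :=
  P = [set x | forall k, coord P k (x k)] /\
  forall k, coord P k !=set0 /\ perfect_set (coord P k).

Definition captures (E : cantor_seq -> cantor_seq -> Prop) (j : nat)
    (P : set cantor_seq) : Prop :=
  forall x y, P x -> P y -> E x y -> x j = y j.

(* [sigL U x] is the restriction of the sequence [x] to the index set [U]. *)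
Definition reduced_to (E : cantor_seq -> cantor_seq -> Prop) (U : set nat)
    (P : set cantor_seq) : Prop :=
  forall x y, P x -> P y -> sigL U x = sigL U y -> E x y.

(* Main.v *)
(** Write E and F as the kernels of Borel maps f and g. Every Borel set is
    relatively clopen on a countable intersection of dense open sets, and such an
    intersection contains a perfect product; parametrizing that product by
    (2^ω)^ω we may assume f and g continuous.

    If on some box f is nowhere constant along a coordinate j while g is constant
    along j, a fusion inside the box makes f capture j, which is (b). Otherwise
    every box has, for every j, a sub-box on which g is nowhere constant along j
    or f is constant along j. A fusion then keeps the following true for any two
    boxes of the current approximation, D being the set of coordinates along
    which they have been separated: either g takes disjoint sets of values on
    them, or f takes equal values at points of the two boxes that agree off D.
    When a coordinate j is split, either f is constant along j and the second
    alternative persists, or g can be made to separate the two halves. In the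
    limit f x <> f y forces g x <> g y, which is (a). The fusion for (b) is the
    same one, applied to x |-> x(j) and f in place of f and g. *)

Require Import Defs.
From mathcomp Require Import all_boot boolp classical_sets functions.
From mathcomp Require Import topology cantor measure.
Set Implicit Arguments.
Unset Strict Implicit.
Unset Printing Implicit Defensive.

Local Open Scope classical_set_scope.

(** * Agreement of points on finitely many bits and coordinates *)

Definition agree n (a b : nat -> bool) := forall i, i < n -> a i = b i.

Definition agree2 m (x y : nat -> nat -> bool) :=
  forall k, k < m -> agree m (x k) (y k).

Lemma agree_sym n a b : agree n a b -> agree n b a.
Proof. by move=> ab i /ab. Qed.

Lemma agree_trans n a b c : agree n a b -> agree n b c -> agree n a c.
Proof. by move=> ab bc i ni; rewrite ab ?bc. Qed.

Lemma agree_le m n a b : m <= n -> agree n a b -> agree m a b.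
Proof. by move=> mn ab i im; apply: ab; exact: leq_trans im mn. Qed.

Lemma agree2_refl m x : agree2 m x x.
Proof. by []. Qed.

Lemma agree2_trans m x y z : agree2 m x y -> agree2 m y z -> agree2 m x z.
Proof. by move=> xy yz k km; apply: agree_trans (xy k km) (yz k km). Qed.

Lemma agree2_le m n x y : m <= n -> agree2 n x y -> agree2 m x y.
Proof. by move=> mn xy k km; apply/(agree_le mn)/xy/(leq_trans km). Qed.

(** * Conditions *)

(* A finite approximation of a product of embeddings of Cantor space: along
   coordinate [k], the input is read up to its first [lev k] bits, and the first
   [prec] bits of the output are fixed. *)
Record condition := Condition {
  lev : nat -> nat;
  prec : nat;
  node : nat -> (nat -> bool) -> nat -> bool;
  node_agree : forall k a b, agree (lev k) a b -> node k a = node k b;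
  node_sep : forall k a b, ~ agree (lev k) a b ->
    k < prec /\ ~ agree prec (node k a) (node k b) }.

Lemma trunk_sep (v : nat -> nat -> bool) M (k : nat) a b : ~ agree 0 a b ->
  k < M /\ ~ agree M (v k) (v k).
Proof. by case. Qed.

Definition trunk v M : condition :=
  @Condition (fun=> 0) M (fun k _ => v k) (fun _ _ _ _ => erefl) (@trunk_sep v M).

(** Nodes are total sequences so that each box comes with a point in it; their bits from [prec p] on
    are only defaults. *)
Definition center p (u : nat -> nat -> bool) := fun k => node p k (u k).

Definition box p u : set (nat -> nat -> bool) := agree2 (prec p) (center p u).

Definition refines p q :=
  prec p <= prec q /\
  forall k a, k < prec p -> agree (prec p) (node p k a) (node q k a).

Definition shrinks p q := refines p q /\ lev q = lev p.

Lemma refines_refl p : refines p p.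
Proof. by split. Qed.

Lemma refines_trans p q r : refines p q -> refines q r -> refines p r.
Proof.
move=> [pq nq] [qr nr]; split=> [|k a kp]; first exact: leq_trans pq qr.
apply: agree_trans (nq k a kp) _; apply: (agree_le pq).
by apply: nr; exact: leq_trans pq.
Qed.

Lemma shrinks_refl p : shrinks p p.
Proof. by split=> //; exact: refines_refl. Qed.

Lemma shrinks_trans p q r : shrinks p q -> shrinks q r -> shrinks p r.
Proof.
by move=> [pq eq] [qr er]; split; [exact: refines_trans pq qr | rewrite er].
Qed.

Lemma refines_box p q u : refines p q -> box q u `<=` box p u.
Proof.
move=> [pq nq] x ux k kp; apply: agree_trans (nq k _ kp) _.
by apply: (agree_le pq); apply/ux/(leq_trans kp).
Qed.

Lemma center_eq p u v :
  (forall k, agree (lev p k) (u k) (v k)) -> center p u = center p v.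
Proof. by move=> uv; apply/funext => k; exact: node_agree. Qed.

Lemma box_center p u : box p u (center p u).
Proof. exact: agree2_refl. Qed.

(** By [node_sep] a coordinate that has been split lies below [prec p], so only finitely many
    coordinates are ever split in one condition. *)
Lemma lev_ge_prec p k : prec p <= k -> lev p k = 0.
Proof.
move=> pk; apply/eqP; rewrite -leqn0 leqNgt; apply/negP => lk.
have /node_sep[] : ~ agree (lev p k) (fun=> false) (fun=> true).
  by move=> /(_ 0 lk).
by rewrite ltnNge pk.
Qed.

(** The node of [u] is overwritten by [x] and that of [v] by [y]; the last hypothesis makes this
    consistent where [u] and [v] share a node. Old bits are kept, so separation survives. *)
Lemma shrink_to_pair p u v x y M : box p u x -> box p v y ->
  (forall k, agree (lev p k) (u k) (v k) -> x k = y k) ->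
  exists q, [/\ shrinks p q, M <= prec q, box q u `<=` agree2 M x &
    box q v `<=` agree2 M y].
Proof.
move=> ux vy xy.
pose nd k a := if `[< agree (lev p k) (u k) a >] then x k else
  if `[< agree (lev p k) (v k) a >] then y k else node p k a.
have ndE k a : k < prec p -> agree (prec p) (node p k a) (nd k a).
  move=> kp; rewrite /nd; case: asboolP => [ua|_].
    by rewrite -(node_agree ua); exact: ux.
  by case: asboolP => // va; rewrite -(node_agree va); exact: vy.
have nd_agree k a b : agree (lev p k) a b -> nd k a = nd k b.
  move=> ab; rewrite /nd (node_agree ab).
  have E w : `[< agree (lev p k) w a >] = `[< agree (lev p k) w b >].
    by apply/asbool_equiv_eq; split=> H; apply: agree_trans H _ => //;
      exact: agree_sym.
  by rewrite !E.
have nd_sep k a b : ~ agree (lev p k) a b ->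
    k < maxn (prec p) M /\ ~ agree (maxn (prec p) M) (nd k a) (nd k b).
  move=> /node_sep[kp ab]; split; first exact: leq_trans (leq_maxl _ _).
  move=> /(agree_le (leq_maxl _ _)) nab; apply: ab.
  apply: agree_trans (ndE k a kp) (agree_trans nab _).
  exact/agree_sym/ndE.
have ndu k : nd k (u k) = x k by rewrite /nd asboolT.
have ndv k : nd k (v k) = y k.
  by rewrite /nd; case: asboolP => [/xy//|_]; rewrite asboolT.
exists (Condition nd_agree nd_sep); split.
- by split=> //; split=> [|k a /ndE//]; exact: leq_maxl.
- exact: leq_maxr.
- move=> z uz; apply: agree2_le (leq_maxr (prec p) M) _ => k kM.
  by rewrite -ndu; exact: uz.
- move=> z vz; apply: agree2_le (leq_maxr (prec p) M) _ => k kM.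
  by rewrite -ndv; exact: vz.
Qed.

Lemma shrink_to p u x M : box p u x ->
  exists q, [/\ shrinks p q, M <= prec q & box q u `<=` agree2 M x].
Proof.
move=> ux; have [|q [? ? ? _]] := @shrink_to_pair p u u x x M ux ux; first by [].
by exists q.
Qed.

(* Up to agreement below [lev p] there are only finitely many inputs. *)
Lemma shrink_all p (R : condition -> (nat -> nat -> bool) -> Prop) :
  (forall q u v, shrinks p q -> (forall k, agree (lev p k) (u k) (v k)) ->
    R q u -> R q v) ->
  (forall q r u, shrinks q r -> R q u -> R r u) ->
  (forall q u, shrinks p q -> exists r, shrinks q r /\ R r u) ->
  exists q, shrinks p q /\ forall u, R q u.
Proof.
move=> Rext Rmono Rdense.
(* Coordinates from [N] on have level 0 and the others have level at most [L], so an [N] by [L]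
   table of bits determines an input as far as [p] reads it. *)
pose N := prec p; pose L := \max_(k < N) lev p k.
pose rep (h : {ffun 'I_N * 'I_L -> bool}) k i : bool :=
  if insub k is Some k' then if insub i is Some i' then h (k', i') else false
  else false.
have [q [pq Rq]] : exists q, shrinks p q /\
    forall h, h \in enum {: {ffun 'I_N * 'I_L -> bool}} -> R q (rep h).
  elim: (enum _) => [|h s [q [pq Rq]]].
    by exists p; split=> //; exact: shrinks_refl.
  have [r [qr Rr]] := Rdense q (rep h) pq.
  exists r; split; first exact: shrinks_trans qr.
  by move=> h'; rewrite inE => /orP[/eqP->//|/Rq]; exact: Rmono.
exists q; split=> // u.
pose h : {ffun 'I_N * 'I_L -> bool} := [ffun ki : 'I_N * 'I_L => u ki.1 ki.2].
have hin : h \in enum {: {ffun 'I_N * 'I_L -> bool}} by rewrite mem_enum.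
apply: Rext pq _ (Rq h hin) => k i.
case: (ltnP k N) => kN; last by rewrite lev_ge_prec.
move=> il; rewrite /rep insubT insubT.
  exact: leq_trans il (leq_bigmax (Ordinal kN)).
by move=> iL; rewrite ffunE.
Qed.

Lemma shrink_all2 p (R : condition -> (nat -> nat -> bool) ->
    (nat -> nat -> bool) -> Prop) :
  (forall q u v u' v', shrinks p q ->
    (forall k, agree (lev p k) (u k) (u' k)) ->
    (forall k, agree (lev p k) (v k) (v' k)) -> R q u v -> R q u' v') ->
  (forall q r u v, shrinks q r -> R q u v -> R r u v) ->
  (forall q u v, shrinks p q -> exists r, shrinks q r /\ R r u v) ->
  exists q, shrinks p q /\ forall u v, R q u v.
Proof.
move=> Rext Rmono Rdense; apply: (@shrink_all p (fun q u => forall v, R q u v)).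
- by move=> q u u' pq uu' Ru v; apply: Rext (Ru v).
- by move=> q r u qr Rq v; apply: Rmono (Rq v).
move=> q u pq; apply: (@shrink_all q (fun r v => R r u v)).
- move=> r v v' qr vv'; have [_ lq] := pq; rewrite lq in vv'.
  by apply: Rext vv' => //; exact: shrinks_trans qr.
- by move=> r r' v; exact: Rmono.
- by move=> r v qr; apply: Rdense; exact: shrinks_trans qr.
Qed.

Lemma split_condition p j : exists q, [/\ refines p q, prec p < prec q &
  lev q = fun k => lev p k + (k == j)].
Proof.
(* The newly read bit is written at output position [m], past the bits already fixed; the new
   precision [m.+1] also exceeds [j], as [node_sep] demands. *)
pose m := maxn (prec p) j.+1.
pose nd k (a : nat -> bool) i :=
  if (k == j) && (i == m) then a (lev p j) else node p k a i.
have ndE k a : agree m (node p k a) (nd k a).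
  by move=> i im; rewrite /nd (ltn_eqF im) andbF.
have nd_agree k a b : agree (lev p k + (k == j)) a b -> nd k a = nd k b.
  move=> ab; apply/funext => i; rewrite /nd.
  rewrite (node_agree (agree_le (leq_addr _ _) ab)).
  case: (eqVneq k j) => [kj|//]; case: ifP => // _.
  by rewrite ab // kj eqxx addn1.
have nd_sep k a b : ~ agree (lev p k + (k == j)) a b ->
    k < m.+1 /\ ~ agree m.+1 (nd k a) (nd k b).
  move=> Nab; case: (pselect (agree (lev p k) a b)) => [ab|/node_sep[kp nab]].
    case: (eqVneq k j) ab Nab => [-> ab Nab|_ ab]; last by rewrite addn0.
    split; first by rewrite ltnS leq_max leqnSn orbT.
    move=> /(_ m (ltnSn _)); rewrite /nd !eqxx /= => abl; apply: Nab => i.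
    by rewrite addn1 ltnS leq_eqVlt => /orP[/eqP->//|]; exact: ab.
  split; first by rewrite ltnS leq_max ltnW.
  move=> /(agree_le (leqnSn _)) ndab; apply: nab.
  apply: agree_le (leq_maxl _ j.+1) _.
  by apply: agree_trans (ndE k a) (agree_trans ndab _); exact: agree_sym.
exists (Condition nd_agree nd_sep); split=> //=; last by rewrite ltnS leq_maxl.
split=> [|k a kp /=]; first by rewrite leqW // leq_maxl.
exact: agree_le (leq_maxl _ _) (ndE k a).
Qed.

(** * Fusion *)

(** By compactness the uniform modulus amounts to continuity. *)
Definition embedding (e : (nat -> bool) -> nat -> bool) :=
  injective e /\
  forall M, exists L, forall a b, agree L a b -> agree M (e a) (e b).

Definition prod_map (e : nat -> (nat -> bool) -> nat -> bool)
    (u : nat -> nat -> bool) : nat -> nat -> bool := fun k => e k (u k).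

(** The 2-adic valuation of [n.+1] takes every value infinitely often, so every coordinate is split
    again and again. *)
Definition schedule n := logn 2 n.+1.

Lemma schedule_io j n : exists2 m, n <= m & schedule m = j.
Proof.
have pos : 0 < 2 ^ j * n.*2.+1 by rewrite muln_gt0 expn_gt0.
exists (2 ^ j * n.*2.+1).-1; last first.
  rewrite /schedule prednK // lognM ?expn_gt0 // pfactorK //.
  by rewrite logn_coprime ?addn0 // coprime2n /= odd_double.
rewrite -ltnS prednK // (leq_trans _ (leq_pmull _ _)) ?expn_gt0 //.
by rewrite ltnS -addnn leq_addr.
Qed.

(** The nodes of the successive conditions converge. The limit maps are injective because levels
    grow without bound and nodes are separated, and continuous because each node reads finitely many
    bits. *)
Lemma fusion (I : nat -> condition -> Prop) p0 : I 0 p0 ->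
  (forall n p, I n p -> exists q, [/\ refines p q, prec p < prec q,
     lev q = (fun k => lev p k + (k == schedule n)) & I n.+1 q]) ->
  exists (e : nat -> (nat -> bool) -> nat -> bool) (p_ : nat -> condition),
    [/\ forall k, embedding (e k), forall n, I n (p_ n),
      forall n u, box (p_ n) u (prod_map e u), forall n, n <= prec (p_ n) &
      forall k L, exists n0, forall n, n0 <= n -> L <= lev (p_ n) k].
Proof.
move=> I0 step.
have /choice[next nextP] : forall np : nat * condition, exists q,
    I np.1 np.2 -> [/\ refines np.2 q, prec np.2 < prec q,
      lev q = (fun k => lev np.2 k + (k == schedule np.1)) & I np.1.+1 q].
  move=> [n p] /=.
  by have [/step[q Hq]|] := pselect (I n p); [exists q | exists p].
pose p_ := fix p_ n := if n is m.+1 then next (m, p_ m) else p0.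
have Ip n : I n (p_ n) by elim: n => //= n /(nextP (n, _))[].
have pP n : [/\ refines (p_ n) (p_ n.+1), prec (p_ n) < prec (p_ n.+1) &
    lev (p_ n.+1) = (fun k => lev (p_ n) k + (k == schedule n))].
  by have [] := nextP (n, p_ n) (Ip n).
have pmono m n : m <= n -> refines (p_ m) (p_ n).
  elim: n => [|n IHn]; first by rewrite leqn0 => /eqP->; exact: refines_refl.
  rewrite leq_eqVlt => /orP[/eqP->|/IHn mn]; first exact: refines_refl.
  by apply: refines_trans mn _; have [] := pP n.
have precp n : n <= prec (p_ n).
  by elim: n => // n IHn; apply: leq_ltn_trans IHn _; have [] := pP n.
have levmono k m n : m <= n -> lev (p_ m) k <= lev (p_ n) k.
  elim: n => [|n IHn]; first by rewrite leqn0 => /eqP->.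
  rewrite leq_eqVlt => /orP[/eqP->//|/IHn mn].
  by have [_ _ ->] := pP n; exact: leq_trans mn (leq_addr _ _).
have levp k L : exists n0, forall n, n0 <= n -> L <= lev (p_ n) k.
  elim: L => [|L [n0 IHL]]; first by exists 0.
  have [m n0m mk] := schedule_io k n0; exists m.+1 => n mn.
  apply: leq_trans (levmono k _ _ mn); have [_ _ ->] := pP m.
  by rewrite mk eqxx addn1 ltnS IHL.
(* At stage [(maxn k i).+1] both [k] and [i] are below the precision, so this output bit is
   final. *)
pose e k a i := node (p_ (maxn k i).+1) k a i.
have eE n k a : k < prec (p_ n) -> agree (prec (p_ n)) (node (p_ n) k a) (e k a).
  move=> kn i ni; rewrite /e; set N := (maxn k i).+1.
  have kN : k < prec (p_ N) by apply: leq_trans (precp N); rewrite ltnS leq_maxl.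
  have iN : i < prec (p_ N) by apply: leq_trans (precp N); rewrite ltnS leq_maxr.
  have [/pmono[_]|/ltnW/pmono[_]] := leqP n N; first exact.
  by move=> H; rewrite H.
exists e, p_; split=> // [k|n u k kn]; last exact: eE.
split=> [a b eab|M].
  apply/funext => i; have [n0 /(_ n0 (leqnn _)) il] := levp k i.+1.
  apply: contrapT => abi.
  have /node_sep[kp] : ~ agree (lev (p_ n0) k) a b by move=> /(_ i il).
  apply; apply: agree_trans (eE _ _ a kp) _; rewrite eab.
  exact/agree_sym/eE.
pose n := maxn M k.+1.
have kn : k < prec (p_ n) by apply: leq_trans (precp n); exact: leq_maxr.
have Mn : M <= prec (p_ n) by apply: leq_trans (precp n); exact: leq_maxl.
exists (lev (p_ n) k) => a b /node_agree ab; apply: (agree_le Mn).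
apply: agree_trans (eE n k b kn); rewrite -ab.
exact/agree_sym/eE.
Qed.

(** * Inclusion of kernels *)

Definition box_continuous (f : (nat -> nat -> bool) -> nat -> bool) :=
  forall x i, exists M, forall y, agree2 M x y -> f x i = f y i.

Definition constant_along (f : (nat -> nat -> bool) -> nat -> bool) j w M :=
  forall x y, agree2 M w x -> agree2 M w y -> (forall k, k <> j -> x k = y k) ->
    f x = f y.

Definition nowhere_constant_along f j w M :=
  forall w' M', M <= M' -> agree2 M w w' -> ~ constant_along f j w' M'.

Lemma agree2_trans_le m n x y z :
  m <= n -> agree2 m x y -> agree2 n y z -> agree2 m x z.
Proof. by move=> mn xy yz; apply: agree2_trans xy (agree2_le mn yz). Qed.

Lemma constant_along_sub f j w M w' M' : M <= M' -> agree2 M w w' ->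
  constant_along f j w M -> constant_along f j w' M'.
Proof.
by move=> MM' ww' cf x y wx wy; apply: cf; apply: agree2_trans_le MM' ww' _.
Qed.

Lemma nowhere_constant_along_sub f j w M w' M' : M <= M' -> agree2 M w w' ->
  nowhere_constant_along f j w M -> nowhere_constant_along f j w' M'.
Proof.
move=> MM' ww' nf z N M'N wz; apply: nf; first exact: leq_trans MM' M'N.
exact: agree2_trans_le ww' wz.
Qed.

Definition box_separated (g : (nat -> nat -> bool) -> nat -> bool) p u v :=
  forall x y, box p u x -> box p v y -> g x <> g y.

(** The coordinates [k] with [agree (lev p k) (u k) (v k)] are those not yet separated. *)
Definition box_tied (f : (nat -> nat -> bool) -> nat -> bool) p u v :=
  forall x y, box p u x -> box p v y ->
    (forall k, agree (lev p k) (u k) (v k) -> x k = y k) -> f x = f y.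

Lemma box_separated_refines g p q u v :
  refines p q -> box_separated g p u v -> box_separated g q u v.
Proof. by move=> pq sg x y /(refines_box pq) ux /(refines_box pq); exact: sg. Qed.

(* If [g] takes two values at points of the box of [u] that differ only at [j],
   one of them is not the value of [g] at a prescribed point of the box of [v]. *)
Lemma shrink_box_separated g p u v j : box_continuous g ->
  ~ agree (lev p j) (u j) (v j) ->
  nowhere_constant_along g j (center p u) (prec p) ->
  exists q, shrinks p q /\ box_separated g q u v.
Proof.
move=> cg uvj ng.
suff [x [y [ux vy xy gxy]]] : exists x y, [/\ box p u x, box p v y,
    forall k, agree (lev p k) (u k) (v k) -> x k = y k & g x <> g y].
  have [i gi] : exists i, g x i <> g y i.
    by apply: contrapT => H; apply: gxy; apply/funext => i; apply: contrapT => gi;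
      apply: H; exists i.
  have [Mx gMx] := cg x i; have [My gMy] := cg y i.
  have [q [pq _ qx qy]] := shrink_to_pair (maxn Mx My) ux vy xy.
  exists q; split=> // x' y' /qx/(agree2_le (leq_maxl _ _))/gMx gx.
  move=> /qy/(agree2_le (leq_maxr _ _))/gMy gy /(congr1 (@^~ i)).
  by rewrite -gx -gy.
have /existsNP[x1 /existsNP[x2]] := ng _ _ (leqnn _) (@box_center p u).
move=> /not_implyP[ux1 /not_implyP[ux2 /not_implyP[x12 gx12]]].
(* [y] follows [x1] on the unseparated coordinates. It matches [x2] there too, since [x1] and [x2]
   differ only at the separated coordinate [j]. *)
pose y k := if `[< agree (lev p k) (u k) (v k) >] then x1 k else node p k (v k).
have vy : box p v y.
  move=> k kp; rewrite /y /center; case: asboolP => // /node_agree <-.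
  exact: ux1.
have [gx1|gx1] := pselect (g x1 = g y); last first.
  by exists x1, y; split=> // k uvk; rewrite /y asboolT.
exists x2, y; split=> //; last by rewrite -gx1 => /esym.
move=> k uvk; rewrite /y asboolT // x12 // => kj.
by apply: uvj; rewrite -kj.
Qed.

Lemma refines_center p q u :
  refines p q -> agree2 (prec p) (center p u) (center q u).
Proof. by move=> pq; apply: (refines_box pq); exact: box_center. Qed.

Definition decided_along f g j p u :=
  nowhere_constant_along g j (center p u) (prec p) \/
  constant_along f j (center p u) (prec p).

Lemma decided_along_refines f g j p q u :
  refines p q -> decided_along f g j p u -> decided_along f g j q u.
Proof.
move=> pq; have pqu := refines_center u pq; have [ple _] := pq.
case=> H; [left; exact: nowhere_constant_along_sub ple pqu H|].
by right; exact: constant_along_sub ple pqu H.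
Qed.

(** The invariant of the fusion. *)
Definition linked f g p := forall u v, box_separated g p u v \/ box_tied f p u v.

Lemma linked_split f g p j : box_continuous g -> linked f g p ->
  (forall q u, shrinks p q -> exists r, shrinks q r /\ decided_along f g j r u) ->
  exists q, [/\ refines p q, prec p < prec q,
    lev q = (fun k => lev p k + (k == j)) & linked f g q].
Proof.
move=> cg lp sortp.
have [p1 [[pp1 l1] sp1]] :
    exists q, shrinks p q /\ forall u, decided_along f g j q u.
  apply: shrink_all sortp => [q u v [_ lq] uv|q r u [qr _]].
    by rewrite /decided_along (@center_eq q u v) // lq.
  exact: decided_along_refines.
have [p2 [p12 lt12 l2]] := split_condition p1 j.
(* The pairs that come apart at [j] in this very split, with [g] nowhere constant along [j] on the
   box of [u]: these must be separated by [g]. *)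
pose splits u v := [/\ agree (lev p1 j) (u j) (v j),
  ~ agree (lev p2 j) (u j) (v j) &
  nowhere_constant_along g j (center p1 u) (prec p1)].
have [p3 [[p23 l3] sep3]] : exists q, shrinks p2 q /\
    forall u v, splits u v -> box_separated g q u v.
  apply: (@shrink_all2 p2 (fun q u v => splits u v -> box_separated g q u v)).
  - move=> q u v u' v' [_ lq] uu' vv' suv [s1 s2 s3].
    have le12 k : lev p1 k <= lev p2 k by rewrite l2 leq_addr.
    rewrite /box_separated /box -(@center_eq q u u') ?lq //.
    rewrite -(@center_eq q v v') ?lq //; apply: suv; split.
    + apply: agree_trans (agree_le (le12 j) (uu' j)) _.
      apply: agree_trans s1 _; apply: agree_sym.
      exact: agree_le (le12 j) (vv' j).
    + move=> uv; apply: s2; apply: agree_trans (agree_sym (uu' j)) _.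
      exact: agree_trans uv (vv' j).
    + rewrite (@center_eq p1 u u') // => k.
      exact: agree_le (le12 k) (uu' k).
  - by move=> q r u v [qr _] H /H; exact: box_separated_refines.
  - move=> q u v [p2q lq].
    have [[_ s2 s3]|Ns] := pselect (splits u v); last first.
      by exists q; split=> //; exact: shrinks_refl.
    have p1q := refines_trans p12 p2q.
    have := @shrink_box_separated g q u v j cg; rewrite lq.
    case=> // [|r [qr sr]]; last by exists r.
    have [ple _] := p1q.
    exact: nowhere_constant_along_sub ple (refines_center u p1q) s3.
have p13 := refines_trans p12 p23.
have p03 := refines_trans pp1 p13.
exists p3; split=> //.
- apply: leq_ltn_trans (proj1 pp1) _; apply: leq_trans lt12 _.
  exact: (proj1 p23).
- by rewrite l3 l2 l1.
move=> u v; have [H|tuv] := lp u v.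
  by left; exact: box_separated_refines p03 H.
have [[ag1 nag2]|same] := pselect (agree (lev p j) (u j) (v j) /\
    ~ agree (lev p3 j) (u j) (v j)).
  case: (sp1 u) => [nuj|cuj]; first by left; apply: sep3; split; rewrite ?l1 -?l3.
  right=> x y ux vy xy.
  (* Moving coordinate [j] of [x] to that of [y] stays in the box of [u], as [u] and [v] shared
     their node at [j] before the split. It leaves [f] unchanged, and the old tie then applies. *)
  pose x' k := if k == j then y k else x k.
  have ux1 : box p1 u x by exact: refines_box p13 _ ux.
  have vy1 : box p1 v y by exact: refines_box p13 _ vy.
  have ux' : box p1 u x'.
    move=> k kp; rewrite /x'; case: eqP => [kj|_]; last exact: ux1.
    rewrite /center (@node_agree p1 k (u k) (v k)); first exact: vy1.
    by rewrite l1 kj.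
  rewrite (cuj x x') //; last by move=> k /eqP/negbTE kj; rewrite /x' kj.
  apply: tuv => [||k uvk].
  - exact: refines_box pp1 _ ux'.
  - exact: refines_box pp1 _ vy1.
  rewrite /x'; case: eqP => // /eqP kj; apply: xy.
  by rewrite l3 l2 l1 /= (negbTE kj) addn0.
(* No new separation at [j] has occurred, so the old tie carries over. *)
right=> x y ux vy xy; apply: tuv => [||k uvk].
- exact: refines_box p03 _ ux.
- exact: refines_box p03 _ vy.
apply: xy; rewrite l3 l2 l1 /=.
case: (eqVneq k j) uvk => [->|_]; last by rewrite addn0.
move=> uvj; apply: contrapT => N; apply: same; split=> //.
by rewrite l3 l2 l1 eqxx.
Qed.

Lemma kernel_inclusion f g v M0 : box_continuous f -> box_continuous g ->
  (forall w M j, M0 <= M -> agree2 M0 v w -> exists w' M',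
    [/\ M <= M', agree2 M w w' & nowhere_constant_along g j w' M' \/
      constant_along f j w' M']) ->
  exists e, [/\ forall k, embedding (e k),
    forall u, agree2 M0 v (prod_map e u) &
    forall u u', g (prod_map e u) = g (prod_map e u') ->
      f (prod_map e u) = f (prod_map e u')].
Proof.
move=> cf cg H.
pose p0 := trunk v M0.
have [||e [p_ [ee Ip ep precp levp]]] :=
    @fusion (fun _ p => refines p0 p /\ linked f g p) p0.
- split=> [|u u']; first exact: refines_refl.
  right=> x y _ _ xy; congr f; apply/funext => k; exact: xy.
- move=> n p [p0p lp].
  have [|q [pq lt lq Lq]] := @linked_split f g p (schedule n) cg lp; last first.
    by exists q; split=> //; split=> //; exact: refines_trans pq.
  move=> q u [pq _]; have p0q := refines_trans p0p pq.
  have [|w' [M' [leM ww' Hw]]] :=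
      H (center q u) (prec q) (schedule n) (proj1 p0q).
    exact: (refines_center u p0q).
  have [r [qr Mr rw]] := shrink_to M' ww'; exists r; split=> //.
  have rc := rw _ (@box_center r u).
  case: Hw => Hw; [left; exact: nowhere_constant_along_sub Mr rc Hw|].
  by right; exact: constant_along_sub Mr rc Hw.
exists e; split=> // [u|u u' guu'].
  exact: (refines_box (proj1 (Ip 0)) (ep 0 u)).
apply/funext => i.
have [M fM] := cf (prod_map e u') i.
(* Stage [n] is late enough that, among the first [M] coordinates, any that differ have been
   separated. *)
have [n [Mn nP]] : exists n, M <= n /\ forall k, k < M ->
    agree (lev (p_ n) k) (u k) (u' k) -> u k = u' k.
  have [n0 n0P] : exists n0, forall n, n0 <= n -> forall k, k < M ->
      agree (lev (p_ n) k) (u k) (u' k) -> u k = u' k.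
    elim: {fM} M => [|M [n1 n1P]]; first by exists 0.
    have [n2 n2P] : exists n2, forall n, n2 <= n ->
        agree (lev (p_ n) M) (u M) (u' M) -> u M = u' M.
      have [uM|/eqP uM] := pselect (u M = u' M); first by exists 0.
      have [i' ui] : exists i', u M i' <> u' M i'.
        apply: contrapT => N; move/eqP: uM; apply; apply/funext => i'.
        by apply: contrapT => ui; apply: N; exists i'.
      have [n2 n2P] := levp M i'.+1; exists n2 => n /n2P il uu.
      by case: ui; exact: uu.
    exists (maxn n1 n2) => n; rewrite geq_max => /andP[/n1P{}n1P /n2P{}n2P] k.
    by rewrite ltnS leq_eqVlt => /orP[/eqP->//|/n1P].
  exists (maxn M n0); split; first exact: leq_maxl.
  by apply: n0P; exact: leq_maxr.
have [_ /(_ u u')[sep|tie]] := Ip n; first by case: (sep _ _ (ep n u) (ep n u')).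
(* [y] follows the image of [u] on unseparated coordinates and that of [u'] elsewhere: the tie gives
   it the value of [f] at the former, continuity gives it bit [i] of [f] at the latter. *)
pose y k := if `[< agree (lev (p_ n) k) (u k) (u' k) >] then e k (u k)
  else e k (u' k).
rewrite (tie _ y (ep n u)).
- apply/esym/fM => k kM; rewrite /y /prod_map; case: asboolP => // /nP -> //.
- move=> k kp; rewrite /y; case: asboolP => [uk|_]; last exact: ep.
  by rewrite /center -(node_agree uk); exact: (ep n u).
- by move=> k uk; rewrite /y asboolT.
Qed.

(** * Borel maps are continuous on a perfect product *)

Definition dense_open (D : set (nat -> nat -> bool)) :=
  (forall x, D x -> exists M, agree2 M x `<=` D) /\
  forall x M, exists y, agree2 M x y /\ D y.

Lemma dense_openT : dense_open setT.
Proof. by split=> [x _|x M]; [exists 0 | exists x]. Qed.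

Lemma dense_open_merge (D : nat -> nat -> set (nat -> nat -> bool)) :
  (forall i n, dense_open (D i n)) ->
  exists D' : nat -> set (nat -> nat -> bool), (forall n, dense_open (D' n)) /\
    forall x, (forall n, D' n x) -> forall i n, D i n x.
Proof.
move=> dD; exists (fun m => if unpickle m is Some (i, n) then D i n else setT).
split=> [m|x Dx i n]; last by have := Dx (pickle (i, n)); rewrite pickleK.
by case: unpickle => [[i n]|]; [exact: dD | exact: dense_openT].
Qed.

(** A fusion puts all boxes of stage [n.+1] inside [D n]; the limit point lies in a box of every
    stage. *)
Lemma dense_open_embedding (D : nat -> set (nat -> nat -> bool)) :
  (forall n, dense_open (D n)) ->
  exists e, (forall k, embedding (e k)) /\ forall u n, D n (prod_map e u).
Proof.
move=> dD.
have [|e [p_ [ee Ip ep _ _]]] := @fusion (fun n p =>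
    if n is m.+1 then forall u, box p u `<=` D m else True)
    (trunk (fun _ _ => false) 0) I.
  move=> n p _; have [q [pq ltpq lq]] := split_condition p (schedule n).
  have [|||r [[qr lr] Dr]] := @shrink_all q (fun r u => box r u `<=` D n).
  - by move=> r u v [_ lr] uv; rewrite /box (@center_eq r u v) // lr.
  - by move=> r s u [rs _] rD; exact: subset_trans (refines_box rs) rD.
  - move=> r u _; have [y [ruy Dy]] := (dD n).2 (center r u) (prec r).
    have [M yM] := (dD n).1 y Dy; have [s [rs _ sy]] := shrink_to M ruy.
    by exists s; split=> //; exact: subset_trans sy yM.
  exists r; split=> //; first exact: refines_trans qr.
    by apply: leq_trans ltpq _; case: qr.
  by rewrite lr.
exists e; split=> // u n; exact: Ip n.+1 u _ (ep n.+1 u).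
Qed.

Definition generically_clopen (A : set (nat -> nat -> bool)) :=
  exists D : nat -> set (nat -> nat -> bool), (forall n, dense_open (D n)) /\
    forall x, (forall n, D n x) -> exists M, forall y, agree2 M x y ->
      (forall n, D n y) -> (A x <-> A y).

(** One more dense open set suffices, that of the points near which membership in [A] is decided. It
    is dense because a box either contains a generic point of [A], around which [A] holds
    generically, or misses [A] generically. *)
Lemma generically_open_clopen (A : set (nat -> nat -> bool))
    (D : nat -> set (nat -> nat -> bool)) :
  (forall n, dense_open (D n)) ->
  (forall x, A x -> (forall n, D n x) -> exists M, forall y, agree2 M x y ->
    (forall n, D n y) -> A y) -> generically_clopen A.
Proof.
move=> dD oA.
pose decided : set (nat -> nat -> bool) := [set x | exists M,
  (forall y, agree2 M x y -> (forall n, D n y) -> A y) \/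
  (forall y, agree2 M x y -> (forall n, D n y) -> ~ A y)].
exists (fun n => if n is m.+1 then D m else decided); split=> [[|n]//|x Dx].
  split=> [x [M xM]|x M].
    exists M => y xy; exists M.
    by case: xM => H; [left|right] => z yz; apply: H; exact: agree2_trans xy yz.
  have [[y [xy Ay Dy]]|N] := pselect (exists y, [/\ agree2 M x y, A y &
      forall n, D n y]).
    by have [M' yM'] := oA y Ay Dy; exists y; split=> //; exists M'; left.
  exists x; split=> //; exists M; right=> y xy Dy Ay; apply: N; by exists y.
have [M [xM|xM]] := Dx 0; exists M => y xy Dy.
  by split=> _; apply: xM => // n; [exact: Dy n.+1 | exact: Dx n.+1].
split=> H; exfalso; first by apply: (xM x) => // n; exact: Dx n.+1.
by apply: (xM y) => // n; exact: Dy n.+1.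
Qed.

(** A countable union is only relatively open on the merged family of dense open sets;
    [generically_open_clopen] then restores clopenness. *)
Lemma sigma_algebra_generically_clopen :
  sigma_algebra setT generically_clopen.
Proof.
split.
- exists (fun=> setT); split=> [n|x _]; first exact: dense_openT.
  by exists 0.
- move=> A [D [dD DA]]; exists D; split=> // x /DA[M xM]; exists M => y xy Dy.
  by have xyE := xM y xy Dy; split=> -[_ NA]; split=> // /xyE.
- move=> A /choice[D DA].
  have [|D' [dD' D'D]] := @dense_open_merge D.
    by move=> i n; have [] := DA i.
  apply: (generically_open_clopen dD') => x [i _ Aix] /D'D D'x.
  have [M xM] := (DA i).2 x (D'x i); exists M => y xy /D'D D'y.
  by exists i => //; apply/(xM y xy (D'y i)).
Qed.

Lemma cantor_nbhsP (a : cantor_space) (U : set cantor_space) :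
  nbhs a U <-> exists L, agree L a `<=` U.
Proof.
split=> [aU|[L aLU]].
  apply: contrapT => /forallNP N.
  have /choice[y yP] : forall L, exists b, agree L a b /\ ~ U b.
    by move=> L; have /existsNP[b /not_implyP[]] := N L; exists b.
  (* Convergence is checked coordinatewise, and each coordinate of [y] is eventually constant. *)
  have : (y : nat -> cantor_space) @ \oo --> a.
    apply/cvg_sup => k V' [V] [[W] oW <-] Wak WV.
    apply: (filterS WV); exists k.+1 => // n /= kn.
    by have [/(_ k kn) <- _] := yP n.
  move=> /(_ U aU); rewrite nbhs_simpl => -[n _ /(_ n (leqnn _)) Uy].
  by have [] := yP n.
apply: filterS aLU _; elim: L => [|L IHL]; first by apply: filterS filterT.
have aL : nbhs a [set b : cantor_space | a L = b L].
  apply: (@proj_continuous nat (fun=> bool) L a [set c | a L = c]).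
  by rewrite nbhs_principalE; move=> _ ->.
apply: filterS (filterI IHL aL) => b [ab aLb] i.
by rewrite ltnS leq_eqVlt => /orP[/eqP->//|/ab].
Qed.

Lemma cantor_seq_open (U : set cantor_seq) x :
  open U -> U x -> exists M, agree2 M x `<=` U.
Proof.
move=> oU Ux; apply: contrapT => /forallNP N.
have /choice[y yP] : forall M, exists z, agree2 M x z /\ ~ U z.
  by move=> M; have /existsNP[z /not_implyP[]] := N M; exists z.
have : (y : nat -> cantor_seq) @ \oo --> x.
  apply/cvg_sup => k V' [V] [[W] oW <-] Wxk WV; apply: (filterS WV).
  have /cantor_nbhsP[L xL] : nbhs (x k) W by exact: open_nbhs_nbhs.
  exists (maxn k.+1 L) => // n /=; rewrite geq_max => /andP[kn Ln].
  by apply: xL; apply: (agree_le Ln); have [+ _] := yP n; exact.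
move=> /(_ U (open_nbhs_nbhs (conj oU Ux))).
by rewrite nbhs_simpl => -[n _ /(_ n (leqnn _)) Uy]; have [] := yP n.
Qed.

Lemma borel_generically_clopen (A : set cantor_seq) :
  borel_set A -> generically_clopen A.
Proof.
apply: smallest_sub; first exact: sigma_algebra_generically_clopen.
move=> U oU; apply: (@generically_open_clopen U (fun=> setT)).
  by move=> _; exact: dense_openT.
by move=> x /(cantor_seq_open oU)[M xM] _; exists M => y /xM.
Qed.

Lemma borel_map_generic (f : cantor_seq -> cantor_space) : borel_map f ->
  exists D : nat -> set (nat -> nat -> bool), (forall n, dense_open (D n)) /\
    forall x i, (forall n, D n x) -> exists M, forall y, agree2 M x y ->
      (forall n, D n y) -> f x i = f y i.
Proof.
move=> bf.
have /choice[D DP] i : generically_clopen [set x | f x i].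
  apply: borel_generically_clopen; rewrite -[X in borel_set X]setTI.
  apply: (bf measurableT [set a | a i]); apply: sub_sigma_algebra.
  rewrite /= openE => a ai; apply/cantor_nbhsP; exists i.+1 => b ab /=.
  by rewrite -ab.
have [|D' [dD' D'D]] := @dense_open_merge D; first by move=> i n; have [] := DP i.
exists D'; split=> // x i /D'D Dx; have [M xM] := (DP i).2 x (Dx i).
by exists M => y xy /D'D Dy; apply/idP/idP => /(xM y xy (Dy i)).
Qed.

(** * Products of embeddings *)

Lemma prod_map_continuous e : (forall k, embedding (e k)) -> forall M,
  exists L, forall u v, agree2 L u v -> agree2 M (prod_map e u) (prod_map e v).
Proof.
move=> ee M.
have /choice[L LP] k : exists L, forall a b,
    agree L a b -> agree M (e k a) (e k b).
  exact: (ee k).2.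
exists (maxn M (\max_(k < M) L k)) => u v uv k kM; apply: LP.
apply: (@agree_le _ (maxn M (\max_(k < M) L k))).
  by rewrite (leq_trans _ (leq_maxr _ _)) // (leq_bigmax (Ordinal kM)).
by apply: uv; rewrite (leq_trans kM) // leq_maxl.
Qed.

Lemma embedding_comp e e' : embedding e -> embedding e' -> embedding (e \o e').
Proof.
move=> [injl cl] [injr cr]; split=> [|M]; first exact: inj_comp.
have [L eL] := cl M; have [L' e'L'] := cr L.
by exists L' => a b /e'L'/eL.
Qed.

Lemma embedding_continuous (e : cantor_space -> cantor_space) :
  embedding e -> continuous e.
Proof.
move=> [_ ce] a U /cantor_nbhsP[M eaU]; have [L eL] := ce M.
by apply/cantor_nbhsP; exists L => b /eL/eaU.
Qed.

Lemma embedding_perfect (e : cantor_space -> cantor_space) :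
  embedding e -> perfect_set (range e).
Proof.
move=> ee; have cl : closed (range e).
  apply: compact_closed; first exact: cantor_space_hausdorff.
  apply: continuous_compact; last exact: cantor_space_compact.
  exact/continuous_subspaceT/embedding_continuous.
split=> //; apply/seteqP; split=> [b /subset_limit_point/cl//|_ [a _ <-] U].
move=> /cantor_nbhsP[M eaU]; have [L eL] := ee.2 M.
(* Flipping bit [L], just beyond the modulus, keeps [e b] in [U], and injectivity makes it a new
   point. *)
pose b i := if i == L then ~~ a i else a i.
exists (e b); split; last 2 first.
- by exists b.
- by apply/eaU/eL => i iL; rewrite /b ltn_eqF.
apply/eqP => /ee.1/(congr1 (@^~ L)); rewrite /b eqxx.
by case: (a L).
Qed.

Lemma perfect_product_range e : (forall k, embedding (e k)) ->
  perfect_product (range (prod_map e) : set cantor_seq).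
Proof.
move=> ee.
have coordE k : coord (range (prod_map e)) k = range (e k).
  apply/seteqP; split=> [_ [_ [u _ <-] <-]|_ [a _ <-]]; first by exists (u k).
  by exists (prod_map e (fun=> a)) => //; exists (fun=> a).
split=> [|k]; last first.
  rewrite coordE; split; last exact: embedding_perfect.
  by exists (e k (fun=> false)); exists (fun=> false).
apply/seteqP; split=> [x Px k|x Px]; first by exists x.
have /choice[u uP] : forall k, exists a, e k a = x k.
  by move=> k; have := Px k; rewrite coordE => -[a _]; exists a.
by exists u => //; apply/funext.
Qed.

(** * The dichotomy for two smooth equivalence relations *)

Theorem theorem2p1 (E F : cantor_seq -> cantor_seq -> Prop)
    (borelE : borel_equivalence E) (smoothE : smooth E)
    (borelF : borel_equivalence F) (smoothF : smooth F) :
  exists P : set cantor_seq, perfect_product P /\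
    ((forall x y, P x -> P y -> F x y -> E x y) \/
     (exists j : nat, captures E j P /\ reduced_to F (~` [set j]) P)).
Proof.
have [f0 /borel_map_generic[D0 [dD0 f0D]] Ef] := smoothE.
have [g0 /borel_map_generic[D1 [dD1 g0D]] Fg] := smoothF.
have [|D [dD DD]] := @dense_open_merge (fun i => if i is 0 then D0 else D1).
  by case.
have [e [ee eD]] := dense_open_embedding dD.
pose f u := f0 (prod_map e u); pose g u := g0 (prod_map e u).
have cf : box_continuous f.
  move=> u i; have [|M fM] := f0D (prod_map e u) i.
    by move=> n; exact: DD (eD u) 0 n.
  have [L eL] := prod_map_continuous ee M.
  by exists L => v /eL uv; apply: fM uv _ => n; exact: DD (eD v) 0 n.
have cg : box_continuous g.
  move=> u i; have [|M gM] := g0D (prod_map e u) i.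
    by move=> n; exact: DD (eD u) 1 n.
  have [L eL] := prod_map_continuous ee M.
  by exists L => v /eL uv; apply: gM uv _ => n; exact: DD (eD v) 1 n.
have [[v [M [j [nf cgj]]]]|N] := pselect (exists v M j,
    nowhere_constant_along f j v M /\ constant_along g j v M).
  have cj : box_continuous (fun x => x j).
    move=> x i; exists (maxn i j).+1 => y.
    by apply; rewrite ltnS ?leq_maxl ?leq_maxr.
  (* Along [j] the map [f] is nowhere constant; along any other coordinate [x j] is constant. So
     every sub-box is already decided. *)
  have [|e' [ee' ve' kere']] := @kernel_inclusion (fun x => x j) f v M cj cf.
    move=> w M' j' MM' vw; exists w, M'; split=> //.
    have [->|/eqP jj'] := eqVneq j' j.
      by left; exact: nowhere_constant_along_sub MM' vw nf.
    by right=> x y _ _; apply; exact/nesym.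
  exists (range (prod_map (fun k => e k \o e' k))); split.
    by apply: perfect_product_range => k; exact: embedding_comp.
  right; exists j; split=> _ _ [u _ <-] [u' _ <-].
    by move=> /Ef/kere' euj; rewrite /prod_map /= -!/(prod_map e' _ j) euj.
  (* Injectivity of [e k] pulls equality off [j] back into the box of [v], where [g] is constant
     along [j]. *)
  move=> uu'; apply/Fg; apply: (cgj (prod_map e' u) (prod_map e' u')) => // k kj.
  apply: (ee k).1; exact: (congr1 (fun h => h (exist _ k (mem_set kj))) uu').
have [|e' [ee' _ kere']] := @kernel_inclusion f g (fun _ _ => false) 0 cf cg.
  (* If [g] is not nowhere constant along [j], it is constant along [j] on a sub-box; there [N]
     forbids [f] to be nowhere constant, which yields a box where [f] is constant along [j]. *)
  move=> w M j _ _.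
  have [ng|/existsNP[w1 /existsNP[M1]]] :=
    pselect (nowhere_constant_along g j w M).
    by exists w, M; split=> //; left.
  move=> /not_implyP[MM1 /not_implyP[ww1 /contrapT cg1]].
  have /existsNP[w2 /existsNP[M2]] : ~ nowhere_constant_along f j w1 M1.
    by move=> nf; apply: N; exists w1, M1, j.
  move=> /not_implyP[M12 /not_implyP[w12 /contrapT cf2]].
  exists w2, M2; split; last by right.
  - exact: leq_trans MM1 M12.
  - exact: agree2_trans_le ww1 w12.
exists (range (prod_map (fun k => e k \o e' k))); split.
  by apply: perfect_product_range => k; exact: embedding_comp.
by left=> _ _ [u _ <-] [u' _ <-] /Fg/kere'/Ef.
Qed.
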